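(* Let $Q\subset\mathbb{R}^d$ be a nonempty compact convex set that is strongly convex with constant $\lambda>0$, let $L_0,L_1>0$, and let $f:\mathbb{R}^d\to\mathbb{R}$ be a convex $(L_0,L_1)$-smooth function such that $\|\nabla f(x)\|>c>0$ for all $x\in Q$, for some constant $c$. Let $f^*=\min_{x\in Q}f(x)$ and let $x_0,x_1,\dots$ be generated by the $(L_0,L_1)$-Frank--Wolfe algorithm with parameters $L_0,L_1$ from a starting point $x_0\in Q$. Then for every $k\ge 0$, $$f(x_{k+1})-f^*\le (f(x_0)-f^* )\,\max\left\{\frac12,\,1-\frac{\lambda}{2eL_1}\right\}^{T}\max\left\{\frac12,\,1-\frac{\lambda c}{2eL_0}\right\}^{K},$$ where $T$ is the number of iterations $i\in\{0,\dots,k\}$ with $L_0\le L_1\|\nabla f(x_i)\|$ and $K$ is the number of iterations $i\in\{0,\dots,k\}$ with $L_0> L_1\|\nabla f(x_i)\|$.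
   Context: $\|\cdot\|$ is the Euclidean norm; $e=\exp(1)$. $(L_0,L_1)$-smoothness: a differentiable $f:\mathbb{R}^d\to\mathbb{R}$ is $(L_0,L_1)$-smooth ($L_0,L_1>0$) if for all $x,y\in\mathbb{R}^d$ with $\|x-y\|\le 1/L_1$ one has $\|\nabla f(x)-\nabla f(y)\|\le (L_0+L_1\|\nabla f(y)\|)\|x-y\|$. Strongly convex set: $Q$ is strongly convex with constant $\lambda>0$ if for any $x,y\in Q$, every point $z$ with $\|z-(x+y)/2\|\le\lambda\|x-y\|^2$ belongs to $Q$. $(L_0,L_1)$-Frank--Wolfe algorithm: for $k=0,1,\dots$, choose any $s_k\in\arg\min_{z\in Q}\nabla f(x_k)^\top z$, set $d_k=s_k-x_k$, $$\alpha_k=\min\left\{1,\ \frac{-\nabla f(x_k)^\top d_k}{(L_0+L_1\|\nabla f(x_k)\|)\,\|d_k\|^2\,e}\right\},\qquad x_{k+1}=x_k+\alpha_kd_k,$$ with the convention $\alpha_k=1$ (so $x_{k+1}=x_k$) if $d_k=0$. *)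

(* Defs.v *)
From HB Require Import structures.
From mathcomp Require Import all_boot all_order all_algebra.
From mathcomp Require Import all_classical all_reals all_analysis.
Import Order.TTheory GRing.Theory Num.Theory.
Import numFieldNormedType.Exports.

Set Implicit Arguments.
Unset Strict Implicit.
Unset Printing Implicit Defensive.

Local Open Scope classical_set_scope.
Local Open Scope ring_scope.

(* Vectors of R^d are rows 'rV[R]_d. The library norm `|v| on this type is the
   sup norm: it gives the same topology, hence the same compact sets and the
   same differentials, but every metric quantity below is Euclidean and uses
   [enorm]. *)

Definition dotp (R : realType) (d : nat) (u v : 'rV[R]_d) : R :=
  \sum_(i < d) u 0 i * v 0 i.

Definition enorm (R : realType) (d : nat) (v : 'rV[R]_d) : R :=
  Num.sqrt (dotp v v).

(* This is the gradient only where [f] is differentiable. *)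
Definition grad (R : realType) (d : nat) (f : 'rV[R]_d -> R) (x : 'rV[R]_d) :
    'rV[R]_d :=
  \row_(i < d) 'D_(delta_mx 0 i) f x.

Definition L0L1_smooth (R : realType) (d : nat) (L0 L1 : R)
    (f : 'rV[R]_d -> R) : Prop :=
  (forall x, differentiable f x) /\
  (forall x y, enorm (x - y) <= 1 / L1 ->
     enorm (grad f x - grad f y) <=
       (L0 + L1 * enorm (grad f y)) * enorm (x - y)).

Definition strongly_convex_set (R : realType) (d : nat) (lambda : R)
    (Q : set 'rV[R]_d) : Prop :=
  forall x y, Q x -> Q y ->
  forall z, enorm (z - 2^-1 *: (x + y)) <= lambda * enorm (x - y) ^+ 2 -> Q z.

Definition linear_argmin (R : realType) (d : nat) (Q : set 'rV[R]_d)
    (g : 'rV[R]_d) : set 'rV[R]_d :=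
  [set s | Q s /\ forall z, Q z -> dotp g s <= dotp g z].

Definition FW_stepsize (R : realType) (d : nat) (L0 L1 : R)
    (f : 'rV[R]_d -> R) (x s : 'rV[R]_d) : R :=
  let dir := s - x in
  if dir == 0 then 1
  else Num.min 1
    (- dotp (grad f x) dir /
       ((L0 + L1 * enorm (grad f x)) * enorm dir ^+ 2 * expR 1)).

(* The choice of [s k] in the argmin is free, so the sequence [s] is a
   parameter along with the iterates [x]. *)
Definition FW_run (R : realType) (d : nat) (L0 L1 : R) (Q : set 'rV[R]_d)
    (f : 'rV[R]_d -> R) (x s : nat -> 'rV[R]_d) : Prop :=
  forall k, linear_argmin Q (grad f (x k)) (s k) /\
    x k.+1 = x k + FW_stepsize L0 L1 f (x k) (s k) *: (s k - x k).

(* Main.v *)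
Require Import Defs.
From HB Require Import structures.
From mathcomp Require Import all_boot all_order all_algebra.
From mathcomp Require Import all_classical all_reals all_analysis.
From mathcomp Require Import lra ring.
Import Order.TTheory GRing.Theory Num.Theory.
Import numFieldNormedType.Exports.

Local Open Scope classical_set_scope.
Local Open Scope ring_scope.

(** Write [g = grad f x], [G = enorm g], [v = s - x], [A = L0 + L1 * G], [a] for
    the step size and [p = - dotp g v] for the Frank-Wolfe gap at an iterate [x].
    Three bounds on one step combine into a contraction of [f x - fstar].

    Upper bound on [a]: by construction [a * A * (enorm v)^2 * e <= p]
    ([FW_stepsize_le]).  Since [p <= G * enorm v], the step is no longer than
    [1 / L1], so smoothness is available between its endpoints; with convexity
    it gives [f (x + a *: v) <= f x - a * p + A * a^2 * (enorm v)^2], and the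
    upper bound with [2 <= e] turns this into a decrease of at least
    [a * p / 2] ([FW_step_decrease]).

    Lower bound on [p]: convexity of [f] and minimality of [s] give
    [f x - fstar <= p].  Hence the step multiplies the distance to the optimum by
    at most [1 - a / 2].

    Lower bound on [a]: strong convexity of [Q] puts a ball around the midpoint
    of [x] and [s] inside [Q], whence [2 * lambda * G * (enorm v)^2 <= p]
    ([strongly_convex_gap]) and [a >= min(1, 2 * lambda * G / (e * A))]
    ([FW_stepsize_ge]).

    So each step contracts by [max(1 / 2, 1 - lambda * G / (e * A))]
    ([FW_contraction]).  As [A <= 2 * L1 * G] or [A <= 2 * L0] according to which
    of [L0] and [L1 * G] is larger, and [c < G], this factor is at most one of the
    two in the theorem, and the bounds multiply along the run. *)

(** * Euclidean inner product and norm *)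

Lemma dotpC {R : realType} {d : nat} (u v : 'rV[R]_d) : dotp u v = dotp v u.
Proof. by apply: eq_bigr => i _; rewrite mulrC. Qed.

Lemma dotpDr {R : realType} {d : nat} (u v w : 'rV[R]_d) :
  dotp u (v + w) = dotp u v + dotp u w.
Proof. by rewrite -big_split; apply: eq_bigr => i _; rewrite mxE mulrDr. Qed.

Lemma dotpZr {R : realType} {d : nat} (a : R) (u v : 'rV[R]_d) :
  dotp u (a *: v) = a * dotp u v.
Proof. by rewrite /dotp mulr_sumr; apply: eq_bigr => i _; rewrite mxE mulrCA. Qed.

Lemma dotpBr {R : realType} {d : nat} (u v w : 'rV[R]_d) :
  dotp u (v - w) = dotp u v - dotp u w.
Proof. by rewrite -[- w]scaleN1r dotpDr dotpZr mulN1r. Qed.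

Lemma dotpBl {R : realType} {d : nat} (u v w : 'rV[R]_d) :
  dotp (u - v) w = dotp u w - dotp v w.
Proof. by rewrite dotpC dotpBr !(dotpC w). Qed.

Lemma dotpZl {R : realType} {d : nat} (a : R) (u v : 'rV[R]_d) :
  dotp (a *: u) v = a * dotp u v.
Proof. by rewrite dotpC dotpZr dotpC. Qed.

Lemma dotp0l {R : realType} {d : nat} (u : 'rV[R]_d) : dotp 0 u = 0.
Proof. by rewrite -(scale0r u) dotpZl mul0r. Qed.

Lemma dotp_ge0 {R : realType} {d : nat} (u : 'rV[R]_d) : 0 <= dotp u u.
Proof. by apply: sumr_ge0 => i _; rewrite -expr2 sqr_ge0. Qed.

Lemma dotp_eq0 {R : realType} {d : nat} (u : 'rV[R]_d) :
  dotp u u = 0 -> u = 0.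
Proof.
move/psumr_eq0P => u0; apply/rowP => i; rewrite mxE.
by apply/eqP; rewrite -sqrf_eq0 expr2 u0 // => j _; rewrite -expr2 sqr_ge0.
Qed.

Lemma enorm_ge0 {R : realType} {d : nat} (u : 'rV[R]_d) : 0 <= enorm u.
Proof. exact: sqrtr_ge0. Qed.

Lemma sqr_enorm {R : realType} {d : nat} (u : 'rV[R]_d) :
  enorm u ^+ 2 = dotp u u.
Proof. exact/sqr_sqrtr/dotp_ge0. Qed.

Lemma enorm_gt0 {R : realType} {d : nat} (u : 'rV[R]_d) :
  u != 0 -> 0 < enorm u.
Proof.
move=> u0; rewrite lt_def enorm_ge0 andbT; apply: contra_neq u0 => u0.
by apply: dotp_eq0; rewrite -sqr_enorm u0 expr0n.
Qed.

Lemma enormZ {R : realType} {d : nat} (a : R) (u : 'rV[R]_d) :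
  enorm (a *: u) = `|a| * enorm u.
Proof.
rewrite /enorm dotpZl dotpZr mulrA -expr2 sqrtrM ?sqr_ge0 //.
by rewrite sqrtr_sqr.
Qed.

(** The square of [enorm v *: u - enorm u *: v] is
    [2 |u| |v| (|u| |v| - u.v)], and it is nonnegative. *)
Lemma dotp_le_enorm {R : realType} {d : nat} (u v : 'rV[R]_d) :
  dotp u v <= enorm u * enorm v.
Proof.
have [->|/enorm_gt0 u0] := eqVneq u 0.
  by rewrite dotp0l mulr_ge0 ?enorm_ge0.
have [->|/enorm_gt0 v0] := eqVneq v 0.
  by rewrite dotpC dotp0l mulr_ge0 ?enorm_ge0.
have := dotp_ge0 (enorm v *: u - enorm u *: v).
rewrite dotpBl !dotpBr !dotpZl !dotpZr -!sqr_enorm (dotpC v u).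
set a := enorm u; set b := enorm v; set c := dotp u v => h.
rewrite -subr_ge0 -(pmulr_rge0 _ (mulr_gt0 u0 v0)) -/a -/b; nra.
Qed.

(** * First-order inequalities for convex and smooth functions *)

Lemma derive_dotp_grad {R : realType} {d : nat} (f : 'rV[R]_d -> R)
    (x v : 'rV[R]_d) :
  differentiable f x -> 'D_v f x = dotp (grad f x) v.
Proof.
move=> df; rewrite deriveE // {1}[v]row_sum_delta linear_sum.
by apply: eq_bigr => i _; rewrite linearZ mxE deriveE // mulrC.
Qed.

Lemma convex_functionT_le {R : realType} {d : nat} (f : 'rV[R]_d -> R)
    (x v : 'rV[R]_d) (t : R) :
  convex_function setT f -> 0 <= t -> t <= 1 ->
  f (t *: v + x) - f x <= t * (f (x + v) - f x).
Proof.
move=> fc t0 t1.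
have : f (t *: (x + v) + (1 - t) *: x) <= t * f (x + v) + (1 - t) * f x.
  by apply: (fc (Itv01 t0 t1)); rewrite in_setT.
rewrite scalerDr scalerBl scale1r addrAC subrKC addrC => h; lra.
Qed.

(** Along a line, convexity bounds every forward difference quotient by the
    increment over the whole segment; the derivative is their limit. *)
Lemma convex_grad_le {R : realType} {d : nat} (f : 'rV[R]_d -> R)
    (x v : 'rV[R]_d) :
  convex_function setT f -> differentiable f x ->
  dotp (grad f x) v <= f (x + v) - f x.
Proof.
move=> fc df; rewrite -derive_dotp_grad //.
have := @diff_derivable _ _ _ f x v df => /cvg_dnbhs_at_right h.
apply: (cvgr_to_le h); near=> t.
have t0 : 0 < t by [].
have t1 : t <= 1 by near: t; exact: nbhs_right_le.
by rewrite /= -[_ *: _]/(_ * _) ler_pdivrMl // convex_functionT_le // ltW.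
Unshelve. all: by end_near. Qed.

(** Convexity at the endpoint [x + v] replaces the integral of the gradient along
    the segment: the increment of [f] is at most [grad f (x + v)] applied to
    [v], which smoothness compares with [grad f x]. *)
Lemma L0L1_smooth_convex_descent {R : realType} {d : nat} {L0 L1 : R}
    {f : 'rV[R]_d -> R} (x v : 'rV[R]_d) :
  convex_function setT f -> L0L1_smooth L0 L1 f -> enorm v <= 1 / L1 ->
  f (x + v) - f x <=
    dotp (grad f x) v + (L0 + L1 * enorm (grad f x)) * enorm v ^+ 2.
Proof.
move=> fc [df smooth] v_small.
have grad_lip := smooth (x + v) x; rewrite addrAC subrr add0r in grad_lip.
have := convex_grad_le f (x + v) (- v) fc (df _).
rewrite addrK -scaleN1r dotpZr => f_up.
have cs := dotp_le_enorm (grad f (x + v) - grad f x) v.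
rewrite dotpBl in cs.
have := ler_wpM2r (enorm_ge0 v) (grad_lip v_small); rewrite -mulrA -expr2; lra.
Qed.

(** * Strongly convex sets *)

(** The minimizer [s] of [z |-> dotp g z] beats the point of [Q] obtained from
    the midpoint of [x] and [s] by moving [lambda * enorm (s - x) ^+ 2] in the
    direction [- g]. *)
Lemma strongly_convex_gap {R : realType} {d : nat} {lambda : R}
    {Q : set 'rV[R]_d} (g x s : 'rV[R]_d) :
  0 < lambda -> strongly_convex_set lambda Q -> Q x -> linear_argmin Q g s ->
  2 * lambda * enorm g * enorm (s - x) ^+ 2 <= - dotp g (s - x).
Proof.
move=> l0 strong Qx [Qs s_min].
have [->|g_neq0] := eqVneq g 0.
  by rewrite /enorm dotp0l sqrtr0 mulr0 mul0r dotp0l oppr0.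
have g0 := enorm_gt0 _ g_neq0.
set r := lambda * enorm (s - x) ^+ 2.
have r0 : 0 <= r by rewrite mulr_ge0 ?sqr_ge0 // ltW.
have := s_min (2^-1 *: (s + x) - (r / enorm g) *: g).
rewrite !dotpBr !dotpZr dotpDr -sqr_enorm expr2 mulrA mulfVK ?gt_eqF //.
have -> : 2 * lambda * enorm g * enorm (s - x) ^+ 2 = 2 * (r * enorm g).
  by rewrite /r; ring.
suff Qz : Q (2^-1 *: (s + x) - (r / enorm g) *: g) by move=> /(_ Qz); lra.
apply: (strong s x Qs Qx).
rewrite addrAC subrr add0r -scaleNr enormZ normrN ger0_norm.
  by rewrite mulfVK // gt_eqF.
by rewrite divr_ge0 // ltW.
Qed.

(** * One Frank-Wolfe step *)

Lemma FW_stepsize_bounds {R : realType} {d : nat} {L0 L1 : R}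
    (f : 'rV[R]_d -> R) (x s : 'rV[R]_d) :
  0 < L0 -> 0 < L1 -> 0 <= - dotp (grad f x) (s - x) ->
  0 <= FW_stepsize L0 L1 f x s <= 1.
Proof.
move=> L0_gt0 L1_gt0 p0; rewrite /FW_stepsize; case: ifP => _.
  by rewrite ler01 lexx.
rewrite ge_min lexx le_min ler01 /= andbT.
apply: divr_ge0 => //; rewrite mulr_ge0 ?expR_ge0 // mulr_ge0 ?sqr_ge0 //.
by rewrite addr_ge0 ?mulr_ge0 ?enorm_ge0 // ltW.
Qed.

(** This holds even in the degenerate case [s = x], where the step size is [1]
    by convention: both sides then vanish. *)
Lemma FW_stepsize_le {R : realType} {d : nat} {L0 L1 : R}
    (f : 'rV[R]_d -> R) (x s : 'rV[R]_d) :
  0 < L0 -> 0 < L1 ->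
  FW_stepsize L0 L1 f x s *
    ((L0 + L1 * enorm (grad f x)) * enorm (s - x) ^+ 2 * expR 1) <=
  - dotp (grad f x) (s - x).
Proof.
move=> L0_gt0 L1_gt0; rewrite /FW_stepsize.
have [->|/enorm_gt0 d0] := eqVneq (s - x) 0.
  by rewrite dotpC dotp0l /enorm dotp0l sqrtr0 expr0n mulr0 mul0r mulr0 oppr0.
rewrite -ler_pdivlMr ?ge_min ?lexx ?orbT //.
rewrite !mulr_gt0 ?exprn_gt0 ?expR_gt0 // ltr_wpDr //.
by rewrite mulr_ge0 ?enorm_ge0 ?ltW.
Qed.

(** The lower bound on the gap is proportional to [enorm (s - x) ^+ 2], as is the
    denominator of the step size, so the distance to [s] cancels. *)
Lemma FW_stepsize_ge {R : realType} {d : nat} {lambda L0 L1 : R}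
    (f : 'rV[R]_d -> R) (x s : 'rV[R]_d) :
  0 < L0 -> 0 < L1 ->
  2 * lambda * enorm (grad f x) * enorm (s - x) ^+ 2
    <= - dotp (grad f x) (s - x) ->
  Num.min 1 (2 * lambda * enorm (grad f x)
             / (expR 1 * (L0 + L1 * enorm (grad f x))))
    <= FW_stepsize L0 L1 f x s.
Proof.
move=> L0_gt0 L1_gt0 gap; rewrite /FW_stepsize.
have [_|/enorm_gt0 d0] := eqVneq (s - x) 0; first by rewrite ge_min lexx.
have A_gt0 : 0 < L0 + L1 * enorm (grad f x).
  by rewrite ltr_wpDr // mulr_ge0 ?enorm_ge0 ?ltW.
have e_gt0 : 0 < expR 1 :> R := expR_gt0 1.
rewrite le_min !ge_min lexx /=; apply/orP; right.
rewrite ler_pdivlMr; last by rewrite !mulr_gt0 ?exprn_gt0.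
apply: le_trans gap; rewrite le_eqVlt; apply/orP; left; apply/eqP.
by field; rewrite !gt_eqF.
Qed.

(** The step is zero if [s = x].  Otherwise it is shorter than [1 / L1]: the
    numerator of the step size is at most [enorm (grad f x) * enorm (s - x)] while
    its denominator exceeds [L1 * enorm (grad f x) * enorm (s - x) ^+ 2].  So
    smoothness applies, and its quadratic term is at most half of the linear one
    since [2 <= expR 1]. *)
Lemma FW_step_decrease {R : realType} {d : nat} {L0 L1 : R}
    {f : 'rV[R]_d -> R} (x s : 'rV[R]_d) (a := FW_stepsize L0 L1 f x s) :
  0 < L0 -> 0 < L1 -> convex_function setT f -> L0L1_smooth L0 L1 f ->
  0 <= - dotp (grad f x) (s - x) ->
  f (x + a *: (s - x)) <= f x - a / 2 * - dotp (grad f x) (s - x).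
Proof.
move=> L0_gt0 L1_gt0 fc fs p0.
have /andP[a0 a1] : 0 <= a <= 1 by exact: FW_stepsize_bounds.
have a_le := FW_stepsize_le f x s L0_gt0 L1_gt0.
rewrite -/a in a_le.
have e2 : 2 <= expR 1 :> R by have := expR_ge1Dx (1 : R); lra.
have cs := dotp_le_enorm (- grad f x) (s - x).
rewrite -scaleN1r dotpZl enormZ normrN normr1 mul1r mulN1r in cs.
have g0 := enorm_ge0 (grad f x); have d0 := enorm_ge0 (s - x).
have small : enorm (a *: (s - x)) <= 1 / L1.
  rewrite enormZ ger0_norm // ler_pdivlMr //.
  have [->|dneq] := eqVneq (s - x) 0.
    by rewrite /enorm dotp0l sqrtr0 mulr0 mul0r ler01.
  have d_gt0 := enorm_gt0 _ dneq.
  have : a * enorm (s - x) * ((L0 + L1 * enorm (grad f x)) * expR 1)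
      <= enorm (grad f x).
    rewrite -(ler_pM2r d_gt0); apply: le_trans (le_trans a_le cs).
    by rewrite le_eqVlt; apply/orP; left; apply/eqP; ring.
  (* If [1 < t * L1], then [G <= t * L1 * G < t * (L0 + L1 * G)], against [tG]. *)
  set t := a * enorm (s - x); set G := enorm (grad f x) => tG.
  have t0 : 0 <= t by rewrite mulr_ge0.
  rewrite leNgt; apply/negP => tL1.
  have tL0 : 0 < t * L0 by apply: mulr_gt0 => //; nra.
  have tLG : G <= t * L1 * G by rewrite -[leLHS]mul1r ler_wpM2r // ltW.
  have : t * (L0 + L1 * G) <= t * ((L0 + L1 * G) * expR 1).
    rewrite ler_wpM2l // -[leLHS]mulr1 ler_wpM2l //; last lra.
    by rewrite addr_ge0 ?mulr_ge0 // ltW.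
  lra.
have := L0L1_smooth_convex_descent x (a *: (s - x)) fc fs small.
rewrite dotpZr enormZ ger0_norm // exprMn.
set A := L0 + _; set D := enorm _ ^+ 2; set p := dotp _ _ => desc.
have AD0 : 0 <= A * D.
  by rewrite mulr_ge0 ?exprn_ge0 // addr_ge0 ?mulr_ge0 // ltW.
have : a * (A * D) * 2 <= - p.
  apply: le_trans a_le; rewrite -mulrA; apply: ler_wpM2l => //.
  exact: ler_wpM2l.
move=> /(ler_wpM2l a0); rewrite expr2 in desc *; lra.
Qed.

(** Convexity gives [f x - fstar <= - dotp (grad f x) (s - x)], so a step of size
    [a] multiplies [f x - fstar] by at most [1 - a / 2]; the lower bound on [a]
    turns this into the two arguments of the maximum. *)
Lemma FW_contraction {R : realType} {d : nat} {Q : set 'rV[R]_d}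
    {f : 'rV[R]_d -> R} {lambda L0 L1 fstar : R} (x s : 'rV[R]_d) :
  0 < lambda -> strongly_convex_set lambda Q -> 0 < L0 -> 0 < L1 ->
  convex_function setT f -> L0L1_smooth L0 L1 f ->
  (exists2 z, Q z & f z = fstar) -> (forall z, Q z -> fstar <= f z) ->
  Q x -> linear_argmin Q (grad f x) s ->
  f (x + FW_stepsize L0 L1 f x s *: (s - x)) - fstar <=
    Num.max (1 / 2) (1 - lambda * enorm (grad f x)
                         / (expR 1 * (L0 + L1 * enorm (grad f x))))
    * (f x - fstar).
Proof.
move=> l0 strong L0_gt0 L1_gt0 fc fs [z Qz fz] fmin Qx s_min.
have gap := strongly_convex_gap (grad f x) x s l0 strong Qx s_min.
have h0 : 0 <= f x - fstar by rewrite subr_ge0 fmin.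
have hp : f x - fstar <= - dotp (grad f x) (s - x).
  have := convex_grad_le f x (z - x) fc (fs.1 x).
  by rewrite subrKC fz !dotpBr; have := s_min.2 z Qz; lra.
have p0 := le_trans h0 hp.
have /andP[a0 _] := FW_stepsize_bounds f x s L0_gt0 L1_gt0 p0.
have dec := FW_step_decrease x s L0_gt0 L1_gt0 fc fs p0.
have a_ge := FW_stepsize_ge f x s L0_gt0 L1_gt0 gap.
move: a0 dec a_ge; set a := FW_stepsize _ _ _ _ _ => a0 dec a_ge.
have step : f (x + a *: (s - x)) - fstar <= (1 - a / 2) * (f x - fstar).
  have := ler_wpM2l a0 hp; lra.
apply: le_trans step _; apply: ler_wpM2r => //.
rewrite le_max; move: a_ge; rewrite ge_min => /orP[a_ge|a_ge]; apply/orP.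
  by left; lra.
by right; lra.
Qed.

(** * Convergence of the algorithm *)

Lemma card_ord_recr (P : pred nat) (n : nat) :
  #|[pred i : 'I_n.+1 | P i]| = (#|[pred i : 'I_n | P i]| + P n)%N.
Proof.
rewrite -!sum1_card big_mkcond big_ord_recr [in RHS]big_mkcond /=.
by congr (_ + _)%N; rewrite inE; case: (P n).
Qed.

(** Where [L0 <= L1 * G], the smoothness constant [L0 + L1 * G] is at most
    [2 * L1 * G], and the factor [G] cancels. *)
Lemma FW_rate_large_grad {R : realType} {lambda L0 L1 G : R} :
  0 < lambda -> 0 < L0 -> 0 < L1 -> 0 < G -> L0 <= L1 * G ->
  lambda / (2 * expR 1 * L1) <= lambda * G / (expR 1 * (L0 + L1 * G)).
Proof.
move=> l0 L0_gt0 L1_gt0 G0 largeG; have e0 : 0 < expR 1 :> R := expR_gt0 1.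
have A0 : 0 < L0 + L1 * G by rewrite addr_gt0 ?mulr_gt0.
rewrite ler_pdivrMr ?mulr_gt0 // mulrAC ler_pdivlMr ?mulr_gt0 //.
have := ler_wpM2l (ltW (mulr_gt0 l0 e0)) largeG; lra.
Qed.

(** Where [L1 * G < L0], the smoothness constant is at most [2 * L0], and [G] is
    only bounded below by [c]. *)
Lemma FW_rate_small_grad {R : realType} {lambda L0 L1 c G : R} :
  0 < lambda -> 0 < L0 -> 0 < L1 -> 0 < c -> c < G -> L1 * G < L0 ->
  lambda * c / (2 * expR 1 * L0) <= lambda * G / (expR 1 * (L0 + L1 * G)).
Proof.
move=> l0 L0_gt0 L1_gt0 c0 cG smallG.
have e0 : 0 < expR 1 :> R := expR_gt0 1; have G0 := lt_trans c0 cG.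
have A0 : 0 < L0 + L1 * G by rewrite addr_gt0 ?mulr_gt0.
rewrite ler_pdivrMr ?mulr_gt0 // mulrAC ler_pdivlMr ?mulr_gt0 //.
have le0 := mulr_gt0 l0 e0.
have := ler_wpM2l (ltW (mulr_gt0 le0 c0)) (ltW smallG).
have := ler_wpM2l (ltW (mulr_gt0 le0 L0_gt0)) (ltW cG); lra.
Qed.

Lemma max_half_le {R : realType} {u v : R} :
  u <= v -> Num.max (1 / 2) (1 - v) <= Num.max (1 / 2) (1 - u).
Proof.
by move=> uv; rewrite ge_max !le_max lexx /= lerD2l lerN2 uv orbT.
Qed.

Lemma segment_in_convex {R : realType} {d : nat} {Q : set 'rV[R]_d}
    (x y : 'rV[R]_d) (t : R) :
  convex_set Q -> Q x -> Q y -> 0 <= t -> t <= 1 -> Q (x + t *: (y - x)).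
Proof.
move=> Qc Qx Qy t0 t1; have := Qc y x (Itv01 t0 t1).
rewrite !inE => /(_ Qy Qx); congr (Q _).
by rewrite -[LHS]/(t *: y + (1 - t) *: x) scalerBl scale1r scalerBr addrCA.
Qed.

Theorem theorem1 (R : realType) (d : nat) (Q : set 'rV[R]_d)
    (f : 'rV[R]_d -> R) (lambda L0 L1 c fstar : R) (x s : nat -> 'rV[R]_d)
    (hQne : Q !=set0) (hQcompact : compact Q) (hQconvex : convex_set Q)
    (hlambda : 0 < lambda) (hQstrong : strongly_convex_set lambda Q)
    (hL0 : 0 < L0) (hL1 : 0 < L1)
    (hfconvex : convex_function setT f) (hfsmooth : L0L1_smooth L0 L1 f)
    (hc : 0 < c) (hgrad : forall z, Q z -> c < enorm (grad f z))
    (hfstar_attained : exists2 z, Q z & f z = fstar)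
    (hfstar_min : forall z, Q z -> fstar <= f z)
    (hx0 : Q (x 0%N)) (hrun : FW_run L0 L1 Q f x s)
    (k : nat) :
  f (x k.+1) - fstar <=
    (f (x 0%N) - fstar)
    * Num.max (1 / 2) (1 - lambda / (2 * expR 1 * L1))
        ^+ #|[pred i : 'I_k.+1 | L0 <= L1 * enorm (grad f (x i))]|
    * Num.max (1 / 2) (1 - lambda * c / (2 * expR 1 * L0))
        ^+ #|[pred i : 'I_k.+1 | L1 * enorm (grad f (x i)) < L0]|.
Proof.
have iterate_in n : Q (x n).
  elim: n => [//|n IH]; have [s_min ->] := hrun n.
  have gap := strongly_convex_gap (grad f (x n)) (x n) (s n)
    hlambda hQstrong IH s_min.
  have p0 : 0 <= - dotp (grad f (x n)) (s n - x n).
    apply: le_trans gap.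
    by rewrite !mulr_ge0 ?exprn_ge0 ?enorm_ge0 // ltW.
  have /andP[a0 a1] := FW_stepsize_bounds f (x n) (s n) hL0 hL1 p0.
  exact: (segment_in_convex (x n) (s n) _ hQconvex IH s_min.1 a0 a1).
pose r1 : R := Num.max (1 / 2) (1 - lambda / (2 * expR 1 * L1)).
pose r2 : R := Num.max (1 / 2) (1 - lambda * c / (2 * expR 1 * L0)).
have half_ge0 : 0 <= 1 / 2 :> R by lra.
have r1_ge0 : 0 <= r1 by rewrite le_max half_ge0.
have r2_ge0 : 0 <= r2 by rewrite le_max half_ge0.
have step n : f (x n.+1) - fstar <=
    r1 ^+ (L0 <= L1 * enorm (grad f (x n)))%R
    * r2 ^+ (L1 * enorm (grad f (x n)) < L0)%R * (f (x n) - fstar).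
  have [s_min ->] := hrun n.
  have := FW_contraction (x n) (s n) hlambda hQstrong hL0 hL1 hfconvex hfsmooth
    hfstar_attained hfstar_min (iterate_in n) s_min.
  move/le_trans; apply; apply: ler_wpM2r.
    by rewrite subr_ge0 hfstar_min.
  have gc := hgrad _ (iterate_in n).
  have [lowG|highG] := leP L0 (L1 * enorm (grad f (x n))).
    rewrite expr1 expr0 mulr1 max_half_le // FW_rate_large_grad //.
    exact: lt_trans gc.
  by rewrite expr0 expr1 [1 * r2]mul1r max_half_le // FW_rate_small_grad.
elim: {k}k.+1 => [|k IH]; first by rewrite !eq_card0 ?expr0 ?mulr1 // => -[].
rewrite !(card_ord_recr (fun i => L0 <= L1 * enorm (grad f (x i)))%R).
rewrite !(card_ord_recr (fun i => L1 * enorm (grad f (x i)) < L0)%R).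
rewrite !exprD -/r1 -/r2; apply: le_trans (step k) _.
have r_ge0 : 0 <= r1 ^+ (L0 <= L1 * enorm (grad f (x k)))%R
    * r2 ^+ (L1 * enorm (grad f (x k)) < L0)%R.
  by rewrite mulr_ge0 ?exprn_ge0.
apply: le_trans (ler_wpM2l r_ge0 IH) _.
rewrite (mulrA (f (x 0%N) - fstar)) [leRHS]mulrACA [leRHS]mulrC.
exact: lexx.
Qed.
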